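(* Consider the fluid model with parameters $\mathbf{\Lambda}$, $\lambda_0$, $\mathbf{G}$ described in the context, with $\mathbf{M}=\mathbf{G}^{-1}\mathbf{\Lambda}$. Suppose that $\mathbf{M}$ is an irreducible non-negative matrix. Then the fluid model is weakly stable if $\rho(\mathbf{M})\le 1$.
   Context: Fix $K\ge 1$, a matrix $\mathbf{\Lambda}=(\lambda_{ij})_{i,j=1}^K$ with $\lambda_{ij}\ge 0$, a column vector $\lambda_0=(\lambda_{01},\dots,\lambda_{0K})^\top$ with $\lambda_{0j}\ge0$, and $\mathbf{G}=\mathrm{diag}(\mu_1,\dots,\mu_K)$ with $\mu_i\in(0,\infty)$. Set $\mathbf{M}=\mathbf{G}^{-1}\mathbf{\Lambda}$, let $\rho(\cdot)$ denote the spectral radius, and $\mathbf{I}$ the identity matrix. Fluid model. A fluid solution is a triple $(\mathbf{Q},\mathbf{T},Y)$ of functions on $[0,\infty)$, with $\mathbf{Q}=(Q_1,\dots,Q_K)^\top$, $\mathbf{T}=(T_1,\dots,T_K)^\top$, such that: each $T_i$ is nondecreasing with $T_i(0)=0$; $Y(t)=t-\sum_{i=1}^K T_i(t)$ is nondecreasing (so each $T_i$ is Lipschitz); $Q_i(t)\ge 0$ for all $i,t$; with $\mathbf{D}(t)=\mathbf{G}\mathbf{T}(t)$, $$\mathbf{Q}(t)=\mathbf{Q}(0)+(\mathbf{M}^\top-\mathbf{I})\mathbf{D}(t)+Y(t)\lambda_0,\qquad t\ge 0;$$ and the discipline is non-idling: $\sum_{i=1}^K\dot T_i(t)=1$ at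 almost every $t$ for which $\mathbf{Q}(t)\ne\mathbf{0}$. The fluid model is weakly stable if every fluid solution with $\mathbf{Q}(0)=\mathbf{0}$ satisfies $\mathbf{Q}(t)=\mathbf{0}$ for all $t\ge 0$. *)

(* Defs.v *)
From HB Require Import structures.
From mathcomp Require Import all_boot all_order all_algebra.
From mathcomp Require Import all_classical all_reals all_analysis.
From mathcomp.real_closed Require Import complex.
Set Implicit Arguments.
Unset Strict Implicit.
Unset Printing Implicit Defensive.
Import Order.TTheory GRing.Theory Num.Theory.
Import numFieldNormedType.Exports.
Local Open Scope classical_set_scope.
Local Open Scope ring_scope.

(* The eigenvalues range over R[i].  For n > 0 this set of moduli is finite and
   nonempty, so the supremum is a maximum. *)
Definition spectral_radius (R : realType) (n : nat) (A : 'M[R]_n) : R :=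
  sup [set Normc.normc z | z in
        [set z : R[i] | eigenvalue (map_mx (real_complex R) A) z]].

(* Reducibility: the indices split into two disjoint nonempty sets S, ~: S such
   that A vanishes on S x ~: S, i.e. A can be brought to block triangular form
   by a simultaneous permutation of rows and columns.  Every 1 x 1 matrix is
   irreducible under this convention, including the zero matrix. *)
Definition reducible_mx (R : realType) (n : nat) (A : 'M[R]_n) : Prop :=
  exists S : {set 'I_n},
    [/\ S != finset.set0, ~: S != finset.set0 &
        forall i j : 'I_n, i \in S -> j \notin S -> A i j = 0].

Definition irreducible_mx (R : realType) (n : nat) (A : 'M[R]_n) : Prop :=
  ~ reducible_mx A.

Definition Gmx (R : realType) (K : nat) (mu : 'rV[R]_K) : 'M[R]_K := diag_mx mu.

Definition Mmx (R : realType) (K : nat) (Lam : 'M[R]_K) (mu : 'rV[R]_K) :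
  'M[R]_K := invmx (Gmx mu) *m Lam.

(* Q, T, Y are total functions on R, of which only the restrictions to
   [0, +oo[ matter.  The non-idling condition ranges over 0 < t so that the
   two-sided derivatives only depend on these restrictions; since derive1 is
   total, the existence of the derivatives is stated explicitly. *)
Record fluid_solution (R : realType) (K : nat) (Lam : 'M[R]_K)
    (lam0 : 'cV[R]_K) (mu : 'rV[R]_K)
    (Q T : R -> 'cV[R]_K) (Y : R -> R) : Prop := FluidSolution {
  fluid_T0 : T 0 = 0 ;
  fluid_T_nondecreasing : forall (i : 'I_K) (s t : R),
    0 <= s -> s <= t -> T s i 0 <= T t i 0 ;
  fluid_YE : forall t : R, 0 <= t -> Y t = t - \sum_(i < K) T t i 0 ;
  fluid_Y_nondecreasing : forall s t : R, 0 <= s -> s <= t -> Y s <= Y t ;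
  fluid_Q_ge0 : forall (i : 'I_K) (t : R), 0 <= t -> 0 <= Q t i 0 ;
  fluid_balance : forall t : R, 0 <= t ->
    Q t = Q 0 + ((Mmx Lam mu)^T - 1%:M) *m (Gmx mu *m T t) + Y t *: lam0 ;
  fluid_nonidling : {ae (@lebesgue_measure R), forall t : R,
    0 < t -> Q t != 0 ->
    (forall i : 'I_K, derivable (fun s : R => T s i 0) t 1) /\
    \sum_(i < K) derive1 (fun s : R => T s i 0) t = 1} }.

Definition weakly_stable (R : realType) (K : nat) (Lam : 'M[R]_K)
    (lam0 : 'cV[R]_K) (mu : 'rV[R]_K) : Prop :=
  forall (Q T : R -> 'cV[R]_K) (Y : R -> R),
    fluid_solution Lam lam0 mu Q T Y -> Q 0 = 0 ->
    forall t : R, 0 <= t -> Q t = 0.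

(* Main.v *)
(* Since M is irreducible with spectral radius at most 1, it has a positive
   subinvariant vector v, M v <= v (in fact its right Perron vector).  As
   v^T (M^T - I) <= 0 and D is nondecreasing, the balance equation bounds the
   increments of w = v^T Q by those of (v^T lam0) Y.  If w(t1) > 0, let a be the
   last zero of w before t1: on ]a, t1] the server never idles, so the Lipschitz
   function Y has derivative 0 almost everywhere there and is constant, whence
   w(t1) <= w(a) = 0. *)

Require Import Defs.
From mathcomp Require Import all_boot all_order all_algebra.
From mathcomp Require Import all_classical all_reals all_analysis.
From mathcomp Require Import lra.
From mathcomp.real_closed Require Import complex.
Import Order.TTheory GRing.Theory Num.Theory.
Import numFieldNormedType.Exports.
Set Implicit Arguments.
Unset Strict Implicit.
Unset Printing Implicit Defensive.
Local Open Scope classical_set_scope.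
Local Open Scope ring_scope.

(** * Eigenvalues and the spectral radius *)

Lemma eigenvalue_col (F : fieldType) (n : nat) (A : 'M[F]_n) (a : F)
    (x : 'cV[F]_n) : A *m x = a *: x -> x != 0 -> eigenvalue A a.
Proof.
(* [eigenvalue] is defined by row eigenvectors. Singularity of [A - a] does not depend on the side,
   and an invertible [A - a] would cancel to give [x = 0]. *)
move=> Ax x0; rewrite /eigenvalue /eigenspace kermx_eq0 row_free_unit.
apply: contra x0 => uA; apply/eqP; rewrite -[x](mulKmx uA).
by rewrite mulmxBl Ax mul_scalar_mx subrr mulmx0.
Qed.

Lemma normc_le_spectral_radius (R : realType) (n : nat) (A : 'M[R]_n) (z : R[i]) :
  eigenvalue (map_mx (real_complex R) A) z -> Normc.normc z <= spectral_radius A.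
Proof.
move=> Az; apply: ub_le_sup; last by exists z.
set p := char_poly (map_mx (real_complex R) A).
have [s ps] := closed_field_poly_normal p.
(* The supremum is meaningful only for a bounded set. Each eigenvalue is one of the roots [s] of the
   characteristic polynomial, so the sum of their moduli is an upper bound. *)
exists (\sum_(y <- s) Normc.normc y) => _ [y Ay <-].
have ys : y \in s.
  move: Ay; rewrite /= eigenvalue_root_char -/p ps (monicP (char_poly_monic _)).
  by rewrite scale1r root_prod_XsubC.
have normc_ge0 (w : R[i]) : 0 <= Normc.normc w by case: w => ? ?; exact: sqrtr_ge0.
by rewrite (big_rem y ys) /= lerDl sumr_ge0.
Qed.

Lemma real_eigenvalue_le_spectral_radius (R : realType) (n : nat) (A : 'M[R]_n)
    (r : R) (x : 'cV[R]_n) :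
  A *m x = r *: x -> x != 0 -> r <= spectral_radius A.
Proof.
move=> Ax x0; apply: le_trans (ler_norm r) _.
have -> : `|r| = Normc.normc (real_complex R r).
  by rewrite /Normc.normc /= expr0n addr0 sqrtr_sqr.
apply: normc_le_spectral_radius.
apply: (@eigenvalue_col _ _ _ _ (map_mx (real_complex R) x)).
  by rewrite -map_mxM Ax map_mxZ.
by rewrite map_mx_eq0.
Qed.

(** * Perron-Frobenius theory for nonnegative irreducible matrices *)

Lemma mulmx_ge0 (R : numDomainType) (m n p : nat) (A : 'M[R]_(m, n))
    (B : 'M[R]_(n, p)) :
  (forall i j, 0 <= A i j) -> (forall i j, 0 <= B i j) ->
  forall i j, 0 <= (A *m B) i j.
Proof. by move=> A0 B0 i j; rewrite mxE sumr_ge0 // => k _; rewrite mulr_ge0. Qed.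

(* The witness is a power of 1 + A: each factor strictly enlarges the support of
   a nonnegative vector that has both zero and nonzero coordinates. *)
Lemma irreducible_positive_multiplier (R : realType) (n : nat) (A : 'M[R]_n)
    (u : 'cV[R]_n) :
  (forall i j, 0 <= A i j) -> irreducible_mx A ->
  (forall i j, 0 <= u i j) -> u != 0 ->
  exists B : 'M[R]_n, [/\ forall i j, 0 <= B i j, A *m B = B *m A
    & forall i, 0 < (B *m u) i 0].
Proof.
move=> A0 irrA; pose Z (u : 'cV[R]_n) := [set i | u i 0 == 0]%SET.
have [k] := ubnP #|Z u|; elim: k u => // k IH u Zk u0 un0.
have [Z0|Zn0] := eqVneq (Z u) finset.set0.
  exists 1%:M; split=> [i j||i]; first by rewrite mxE ler0n.
    by rewrite mulmx1 mul1mx.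
  rewrite mul1mx lt_neqAle u0 andbT eq_sym.
  by have := finset.in_set0 i; rewrite -Z0 inE => ->.
have CZn0 : ~: Z u != finset.set0.
  apply: contraNneq un0 => CZ0; apply/eqP/colP => i; rewrite !mxE.
  by have := finset.in_set0 i; rewrite -CZ0 !inE => /negPn/eqP.
(* If no such entry existed, the zero set of [u] would reduce [A]. This entry makes coordinate [i]
   of [(1 + A) u] positive, so the zero set shrinks. *)
have [i [j [iZ jZ Aij]]] : exists i j, [/\ i \in Z u, j \notin Z u & A i j != 0].
  apply: contrapT => h; apply: irrA; exists (Z u); split=> // i j iZ jZ.
  by apply: contrapT => /eqP Aij; apply: h; exists i, j.
pose u' := (1%:M + A) *m u.
have B0 p q : 0 <= (1%:M + A) p q by rewrite !mxE addr_ge0.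
have u'E p : u' p 0 = u p 0 + (A *m u) p 0 by rewrite /u' mulmxDl mul1mx mxE.
have Au0 := mulmx_ge0 A0 u0.
have [||B' [B'0 B'A B'u]] := IH u' _ (mulmx_ge0 B0 u0).
- apply: leq_trans (_ : #|Z u| <= k)%N; last by rewrite -ltnS.
  apply/proper_card/properP; split.
    apply/fintype.subsetP => p; rewrite !inE u'E paddr_eq0 //.
    by case/andP.
  exists i => //; rewrite inE u'E paddr_eq0 // negb_and; apply/orP; right.
  rewrite mxE psumr_neq0 => [|q _]; last by rewrite mulr_ge0.
  apply/hasP; exists j; rewrite ?mem_index_enum //= mulr_gt0 //.
    by rewrite lt_neqAle eq_sym Aij A0.
  by rewrite lt_neqAle eq_sym u0 andbT; move: jZ; rewrite inE.
- apply: contraNneq un0 => u'0; apply/eqP/colP => p; apply/eqP.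
  have /eqP := u'E p; rewrite u'0 mxE eq_sym paddr_eq0 //.
  by case/andP.
exists (B' *m (1%:M + A)); split; first exact: mulmx_ge0.
  by rewrite mulmxA B'A -!mulmxA; congr (_ *m _); rewrite mulmxDl mulmxDr mulmx1 mul1mx.
by move=> p; rewrite -mulmxA.
Qed.

Lemma linear_form_continuous (R : realType) (n : nat) (c : 'I_n -> R) :
  continuous (fun x : 'rV[R]_n => \sum_j c j * x 0 j).
Proof.
apply: continuous_big => [|j _ x]; first exact: add_continuous.
by apply: (@continuousM _ _ (cst (c j))); [exact: cst_continuous|exact: coord_continuous].
Qed.

(* Collatz-Wielandt: the largest r with r x <= A x for some x in the simplex. *)
Lemma collatz_wielandt_max (R : realType) (n : nat) (A : 'M[R]_n.+1) :
  (forall i j, 0 <= A i j) ->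
  exists r (x : 'cV[R]_n.+1),
    [/\ 0 <= r, forall i, 0 <= x i 0, x != 0,
        forall i, r * x i 0 <= (A *m x) i 0
      & forall r' (y : 'cV[R]_n.+1), (forall i, 0 <= y i 0) -> y != 0 ->
          (forall i, r' * y i 0 <= (A *m y) i 0) -> r' <= r].
Proof.
move=> A0.
(* Summing [r x_i <= (A x)_i] over the simplex, where every [x_j <= 1], gives [r <= B]. The feasible
   pairs [(r, x)] with [0 <= r] therefore form a compact set [P]. *)
pose B := \sum_i \sum_j A i j.
pose C i := [set p : R * 'rV[R]_n.+1 | 0 <= \sum_j A i j * p.2 0 j - p.1 * p.2 0 i]%classic.
pose D := [set p : R * 'rV[R]_n.+1 | \sum_j 1 * p.2 0 j = 1]%classic.
pose box := (`[0, B] `*` [set x : 'rV[R]_n.+1 | forall i, `[0, 1]%classic (x ord0 i)])%classic.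
pose P := (box `&` (\bigcap_(i in setT) C i `&` D))%classic.
have Bge0 : 0 <= B by rewrite sumr_ge0 // => i _; rewrite sumr_ge0.
have snd_continuous (f : 'rV[R]_n.+1 -> R) : continuous f ->
    continuous (fun p : R * 'rV[R]_n.+1 => f p.2).
  by move=> cf p; apply: (@continuous_comp _ _ _ snd f); [exact: cvg_snd|exact: cf].
have cP : compact P.
  apply: compact_closedI.
    apply: compact_setX; first exact: segment_compact.
    by apply: (@rV_compact R n.+1 (fun=> `[0, 1]%classic)) => i; exact: segment_compact.
  apply: closedI.
    apply: closed_bigI => i _.
    apply: (@preimage_closed _ _ _ [set x : R | 0 <= x]%classic); last exact: closed_ge.
    move=> p _; apply: cvgB; first exact: (snd_continuous _ (@linear_form_continuous R n.+1 (A i))).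
    by apply: cvgM; [exact: cvg_fst|exact: (snd_continuous (fun x => x 0 i) (@coord_continuous _ _ _ _ _))].
  apply: (@preimage_closed _ _ _ [set x : R | x = 1]%classic); last exact: closed_eq.
  by move=> p _; exact: (snd_continuous _ (@linear_form_continuous R n.+1 (fun=> 1))).
have P0 : (P !=set0)%classic.
  exists (0, delta_mx 0 ord0); split; last split => /=.
  - split=> [|i] /=; rewrite in_itv /= ?lexx ?Bge0 // mxE.
    by rewrite ler0n lern1 leq_b1.
  - move=> i _ /=; rewrite /C /= mul0r subr0 sumr_ge0 // => j _.
    by rewrite mulr_ge0 // mxE ler0n.
  - rewrite /D /= (bigD1 ord0) //= big1 => [|j j0]; rewrite ?mxE mul1r ?mxE.
      by rewrite !eqxx addr0.
    by rewrite (negbTE j0) andbF.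
have [|[r x]] := @compact_EVT_max _ R fst P P0 cP.
  by apply: continuous_subspaceT => p; exact: cvg_fst.
rewrite in_setE => -[[/= ]]; rewrite in_itv /= => /andP[r0 rB] x01 [Cx Dx] rmax.
have mulE (y : 'cV[R]_n.+1) i : (A *m y) i 0 = \sum_j A i j * y^T 0 j.
  by rewrite mxE; apply: eq_bigr => j _; rewrite mxE.
exists r, x^T; split=> //.
- by move=> i; rewrite mxE; have := x01 i; rewrite /= in_itv /= => /andP[].
- apply: contra_eqN Dx => /eqP /(congr1 trmx); rewrite trmxK trmx0 => ->.
  by rewrite /= big1 1?eq_sym ?oner_eq0 // => j _; rewrite mxE mulr0.
- by move=> i; rewrite mulE trmxK mxE -subr_ge0; exact: (Cx i).
move=> r' y y0 yn0 Ay; have [r'0|r'0] := ltP r' 0; first exact: le_trans (ltW r'0) r0.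
pose s := \sum_j y j 0.
have s0 : 0 < s.
  rewrite lt_neqAle sumr_ge0 // andbT eq_sym; apply: contra yn0 => /eqP s0.
  apply/eqP/colP => i; rewrite mxE; apply/eqP.
  by move/eqP: s0; rewrite psumr_eq0 // => /allP/(_ i); rewrite mem_index_enum => /(_ isT).
pose z : 'rV[R]_n.+1 := s^-1 *: y^T.
have zE i : z 0 i = s^-1 * y i 0 by rewrite !mxE.
have z0 i : 0 <= z 0 i by rewrite zE mulr_ge0 // invr_ge0 ltW.
have z_sum : \sum_i z 0 i = 1.
  by under eq_bigr do rewrite zE; rewrite -mulr_sumr mulVf // gt_eqF.
have z1 i : z 0 i <= 1.
  by rewrite -z_sum (bigD1 i) //= lerDl sumr_ge0.
have Az i : r' * z 0 i <= \sum_j A i j * z 0 j.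
  under eq_bigr do rewrite zE mulrCA.
  rewrite -mulr_sumr zE mulrCA ler_pM2l ?invr_gt0 //.
  by apply: le_trans (Ay i) _; rewrite mxE.
apply: (rmax (r', z)); rewrite in_setE; split; last split.
- split=> [|i] /=; rewrite in_itv /= ?z0 ?z1 // r'0 /=.
  rewrite -[r']mulr1 -z_sum mulr_sumr; apply: ler_sum => i _.
  by apply: le_trans (Az i) _; apply: ler_sum => j _; rewrite ler_piMr.
- by move=> i _; rewrite /C /= subr_ge0.
- by rewrite /D /=; under eq_bigr do rewrite mul1r.
Qed.

(** A Collatz-Wielandt maximizer [x] must be an eigenvector: a nonzero residual [A x - r x] becomes
    strictly positive under a multiplier [B] commuting with [A], and then [B x] admits a value
    larger than [r]. The spectral radius bounds this real eigenvalue, so [r <= 1]. *)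
Lemma perron_subinvariant (R : realType) (n : nat) (A : 'M[R]_n) :
  (0 < n)%N -> (forall i j, 0 <= A i j) -> irreducible_mx A ->
  spectral_radius A <= 1 ->
  exists v : 'cV[R]_n, forall i, 0 < v i 0 /\ (A *m v) i 0 <= v i 0.
Proof.
case: n A => // n A _ A0 irrA rho1.
have [r [x [r0 x0 xn0 Ax rmax]]] := collatz_wielandt_max A0.
have u0 i j : 0 <= (A *m x - r *: x) i j.
  by rewrite (ord1 j) !mxE subr_ge0; apply: le_trans (Ax i) _; rewrite mxE.
have Axr : A *m x = r *: x.
  apply/eqP; rewrite -subr_eq0; apply: contraT => un0.
  have [B [B0 BA Bu]] := irreducible_positive_multiplier A0 irrA u0 un0.
  pose y := B *m x.
  have y0 i : 0 <= y i 0 by apply: mulmx_ge0 => // k j; rewrite (ord1 j).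
  have BuE i : (B *m (A *m x - r *: x)) i 0 = (A *m y) i 0 - r * y i 0.
    by rewrite mulmxBr mulmxA -BA -mulmxA -scalemxAr mxE; congr (_ + _); rewrite !mxE.
  have yn0 : y != 0.
    apply/eqP => yE; have := Bu ord0.
    by rewrite BuE yE mulmx0 !mxE mulr0 subrr ltxx.
  pose i0 := [arg min_(i < ord0) (B *m (A *m x - r *: x)) i 0]%O.
  (* [s] exceeds every coordinate of [y], so [d * y_i <= d * s], the least entry of the positive
     residual of [y]. Hence [r + d] is still feasible. *)
  pose s := 1 + \sum_i y i 0.
  have s0 : 0 < s by rewrite ltr_pwDl // sumr_ge0.
  pose d := (B *m (A *m x - r *: x)) i0 0 / s.
  have d0 : 0 < d by rewrite divr_gt0.
  suff : r + d <= r by rewrite gerDl leNgt d0.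
  apply: (rmax _ y) => // i; rewrite mulrDl -lerBrDl -BuE.
  apply: (@le_trans _ _ (d * s)).
    rewrite ler_wpM2l //; first exact: ltW.
    by rewrite /s (bigD1 i) //= addrCA lerDl addr_ge0 ?ler01 ?sumr_ge0.
  rewrite /d divfK ?gt_eqF //.
  by rewrite /i0; case: arg_minP => // k _; apply.
have r1 : r <= 1 by apply: le_trans rho1; exact: real_eigenvalue_le_spectral_radius Axr xn0.
exists x => i; split; last first.
  by rewrite Axr mxE ler_piMl.
rewrite lt_neqAle x0 andbT eq_sym; apply: contra_notN irrA => /eqP xi0.
(* The zero set of an eigenvector [x >= 0] is reducing: if [x_p = 0] then the nonnegative terms
   [A p q * x_q] sum to zero, so [A p q = 0] wherever [x_q] is nonzero. *)
exists [set k | x k 0 == 0]%SET; split.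
- by apply/set0Pn; exists i; rewrite inE xi0.
- apply: contraNneq xn0 => Z0; apply/eqP/colP => k; rewrite !mxE.
  by have := finset.in_set0 k; rewrite -Z0 !inE => /negPn/eqP.
- move=> p q; rewrite !inE => /eqP xp xq.
  have /eqP : (A *m x) p 0 = 0 by rewrite Axr mxE xp mulr0.
  rewrite mxE psumr_eq0 => [/allP/(_ q)|k _]; last by rewrite mulr_ge0.
  by rewrite mem_index_enum mulf_eq0 (negbTE xq) orbF => /(_ isT)/eqP.
Qed.

(** * Monotonicity on an interval from one-sided growth bounds *)

(** The one-sided growth bound forbids upward jumps, so the supremum of the sublevel set still
    belongs to it; continuity is not assumed. *)
Lemma last_sublevel_point (R : realType) (F : R -> R) (a b C c : R) :
  a <= b -> F a <= c ->
  (forall s t, a <= s -> s <= t -> t <= b -> F t - F s <= C * (t - s)) ->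
  exists s, [/\ a <= s, s <= b, F s <= c &
    forall t, s < t -> t <= b -> c < F t].
Proof.
move=> ab Fa FC.
pose S := [set s | [/\ a <= s, s <= b & F s <= c]]%classic.
have Sa : S a by split.
have Sb : ubound S b by move=> s [].
have S_sup : has_sup S by split; [exists a | exists b].
have supb : sup S <= b by apply: ge_sup => //; exists a.
have supa : a <= sup S by apply: ub_le_sup => //; exists b.
exists (sup S); split=> //.
  apply/ler_addgt0Pr => e e0.
  have C0 : 0 < 1 + `|C| by rewrite ltr_pwDl.
  have [s [as_ sb Fs] s_sup] := sup_adherent (divr_gt0 e0 C0) S_sup.
  have s_le : s <= sup S by apply: ub_le_sup; [exists b|].
  rewrite -lerBlDl; apply: le_trans (_ : F (sup S) - F s <= _); first by lra.
  apply: le_trans (FC _ _ as_ s_le supb) _.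
  apply: le_trans (_ : (1 + `|C|) * (sup S - s) <= _).
    apply: ler_wpM2r; first by rewrite subr_ge0.
    by rewrite (le_trans (ler_norm C)) // lerDr.
  by rewrite mulrC -ler_pdivlMr //; move: s_sup; lra.
move=> t st tb; rewrite ltNge; apply/negP => Ft.
suff : t <= sup S by rewrite leNgt st.
apply: ub_le_sup; first by exists b.
by split=> //; exact: le_trans supa (ltW st).
Qed.

Lemma le_of_local_descent (R : realType) (F : R -> R) (a b C : R) :
  a <= b ->
  (forall s t, a <= s -> s <= t -> t <= b -> F t - F s <= C * (t - s)) ->
  (forall t, a <= t -> t < b -> exists t', [/\ t < t', t' <= b & F t' <= F t]) ->
  F b <= F a.
Proof.
move=> ab FC desc.
have [s [as_ sb Fs smax]] := last_sublevel_point ab (lexx _) FC.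
move: sb; rewrite le_eqVlt => /predU1P[<- //|sb].
have [t [st tb Ft]] := desc _ as_ sb.
by have := smax _ st tb; rewrite ltNge (le_trans Ft Fs).
Qed.

(** The right difference quotients converge to a limit below [e], so one with a small enough step is
    below [e]. The slack is there because a zero derivative still allows growth. *)
Lemma derive_le0_right_bound (R : realType) (F : R -> R) (t b e : R) :
  t < b -> 0 < e -> derivable F t 1 -> derive1 F t <= 0 ->
  exists t', [/\ t < t', t' <= b & F t' - F t <= e * (t' - t)].
Proof.
move=> tb e0 dF dF0.
have : ((fun h => h^-1 *: ((F \o shift t) (h *: (1 : R)) - F t)) x @[x --> (0:R)^'+] --> derive1 F t)%classic.
  by apply: cvg_dnbhs_at_right; rewrite derive1E; exact: dF.
move=> /cvgr_lt /(_ _ (le_lt_trans dF0 e0)) Fe.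
have /filter_ex[h [h0 hb hF]] : \forall h \near (0:R)^'+, [/\ 0 < h, h < b - t &
    h^-1 *: ((F \o shift t) (h *: (1 : R)) - F t) < e].
  near=> h; split; near: h => //; first exact: nbhs_right_gt.
  by apply: nbhs_right_lt; rewrite subr_gt0.
exists (t + h); split; [by rewrite ltrDl|by rewrite -lerBrDl ltW|].
move: hF; rewrite /= /shift /= [h *: 1]mulr1 [h + t]addrC.
by rewrite /GRing.scale /= mulrC ltr_pdivrMr // => /ltW; rewrite [t + h - t]addrAC subrr add0r.
Unshelve. all: by end_near. Qed.

(* A null set N containing the exceptional points is covered by an open U of small
   measure d.  Subtracting d t + L |U `&` [a, t]| from F gives a function that can
   always descend a little to the right: off N by the derivative, and inside U
   because the last term grows at rate L. *)
Lemma ae_derive_le0_nonincreasing (R : realType) (F : R -> R) (a b L : R) :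
  a <= b -> 0 <= L ->
  (forall s t, a <= s -> s <= t -> t <= b -> F t - F s <= L * (t - s)) ->
  {ae (@lebesgue_measure R), forall t, a < t -> t < b ->
     derivable F t 1 /\ derive1 F t <= 0} ->
  F b <= F a.
Proof.
move=> ab L0 FL aeF.
pose mu := @lebesgue_measure R.
(* The endpoint [a] is outside the reach of the derivative hypothesis; adding it to the null set
   places it in the open cover. *)
have [N [mN N0 subN]] : mu.-negligible
    (~` [set t | a < t -> t < b -> derivable F t 1 /\ derive1 F t <= 0] `|` [set a])%classic.
  by apply: negligibleU => //; apply/negligibleP; [exact: measurable_set1|exact: lebesgue_measure_set1].
apply/ler_addgt0Pr => e e0.
(* Undoing both corrections costs at most [d * (b - a) + L * d <= d * k = e]; the summand 1 keeps
   [k] positive. *)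
pose k := 1 + L + (b - a).
have k0 : 0 < k by rewrite /k; lra.
pose d := e / k.
have d0 : 0 < d by rewrite divr_gt0.
have [] := @lebesgue_regularity_outer R N d mN _ d0.
  by rewrite [X in (X < _)%E](_ : _ = 0%E) // N0.
move=> U [oU NU Ud].
have mUN : measurable U by exact: measurable_realfun.open_measurable.
have mu_U : (mu U < d%:E)%E.
  have UDI : mu U = (mu (U `\` N) + mu (U `&` N))%E := measureDI mu mUN mN.
  apply: le_lt_trans Ud; rewrite UDI -[leRHS]adde0 leeD2l //.
  rewrite -N0; apply: le_measure; rewrite ?inE //; exact: measurableI.
pose g t := fine (mu (U `&` `[a, t])%classic).
have mI t : measurable (U `&` `[a, t])%classic by apply: measurableI => //; exact: measurable_itv.
have mu_le t : (mu (U `&` `[a, t]%classic) <= mu U)%E.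
  by apply: le_measure; rewrite ?inE //; exact: mI.
have g_fin t : mu (U `&` `[a, t])%classic \is a fin_num.
  rewrite ge0_fin_numE // (le_lt_trans (mu_le t)) // (lt_trans mu_U) //.
  exact: ltry.
have gE s t : a <= s -> s <= t -> g t - g s = fine (mu (U `&` `]s, t])%classic).
  move=> as_ st.
  have mI' : measurable (U `&` `]s, t])%classic.
    by apply: measurableI => //; exact: measurable_itv.
  have UE : (U `&` `[a, t] = (U `&` `[a, s]) `|` (U `&` `]s, t]))%classic.
    rewrite -setIUr; congr (_ `&` _)%classic.
    apply/seteqP; split=> x /=; rewrite !in_itv /=.
      by move=> /andP[-> ->]; case: (leP x s); [left|right].
    case=> /andP[h1 h2]; apply/andP; split=> //; first exact: le_trans st.
    exact: ltW (le_lt_trans as_ h1).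
  have muE : mu (U `&` `[a, t])%classic =
      (mu (U `&` `[a, s])%classic + mu (U `&` `]s, t])%classic)%E.
    have disj : ((U `&` `[a, s]) `&` (U `&` `]s, t]) = set0)%classic.
      apply/seteqP; split=> x //=; rewrite !in_itv /= => -[[_ /andP[_ xs]]].
      by move=> [_ /andP[sx _]]; move: sx; rewrite ltNge xs.
    by rewrite UE; exact: (measureU lebesgue_measure (mI s) mI' disj).
  have fI' : mu (U `&` `]s, t])%classic \is a fin_num.
    by have := g_fin t; rewrite muE fin_numD => /andP[].
  by rewrite /g muE fineD // addrC addKr.
have g_mono s t : a <= s -> s <= t -> g s <= g t.
  by move=> as_ st; rewrite -subr_ge0 gE // fine_ge0.
have g_gap s t : a <= s -> s <= t -> (`]s, t] `<=` U)%classic -> g t - g s = t - s.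
  move=> as_ st sub; rewrite gE // (setIidr sub) [mu _]lebesgue_measure_itv /= lte_fin.
  by case: ltP => // ts; rewrite (@le_anti _ _ s t) ?subrr // st ts.
have ga : 0 <= g a by rewrite fine_ge0.
have gb : g b <= d.
  rewrite -[d]/(fine d%:E) fine_le //.
  exact: ltW (le_lt_trans (mu_le b) mu_U).
pose G t := F t - d * t - L * g t.
have GL s t : a <= s -> s <= t -> t <= b -> G t - G s <= L * (t - s).
  move=> as_ st tb; have := FL _ _ as_ st tb.
  have : L * g s <= L * g t by rewrite ler_wpM2l // g_mono.
  have : d * s <= d * t by rewrite ler_pM2l.
  rewrite /G; lra.
suff : G b <= G a.
  rewrite /G => h.
  have h1 : L * g b <= L * d by rewrite ler_wpM2l.
  have h2 : 0 <= L * g a by rewrite mulr_ge0.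
  have : d * k = e by rewrite /d divfK // gt_eqF.
  rewrite /k; lra.
apply: le_of_local_descent GL _ => // t at_ tb.
have [Ut|nUt] := pselect (U t).
  have [r /= r0 rU] := (nbhs_ballP t U).1 (open_nbhs_nbhs (conj oU Ut)).
  pose t' := Num.min (t + r / 2) b.
  have r20 : 0 < r / 2 by rewrite divr_gt0.
  have tt' : t < t' by rewrite lt_min tb andbT ltrDl.
  have t'r : t' <= t + r / 2 by rewrite ge_min lexx.
  have t'b : t' <= b by rewrite ge_min lexx orbT.
  exists t'; split=> //.
  have gE' : g t' - g t = t' - t.
    apply: g_gap => //; first exact: ltW.
    move=> x /=; rewrite in_itv /= => /andP[tx xt']; apply: rU.
    by rewrite /ball /= ltr0_norm; lra.
  have := FL _ _ at_ (ltW tt') t'b; rewrite -gE' mulrBr.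
  have : d * t <= d * t' by rewrite ler_pM2l // ltW.
  rewrite /G; lra.
have {}nUt : ~ N t by move=> /NU.
have at' : a < t.
  rewrite lt_neqAle at_ andbT; apply: contra_notN nUt => /eqP <-.
  by apply: subN; right.
have [dF dF0] : derivable F t 1 /\ derive1 F t <= 0.
  by apply: contrapT => h; apply: nUt; apply: subN; left => /(_ at' tb).
have [t' [tt' tb' Ft']] := derive_le0_right_bound tb d0 dF dF0.
exists t'; split=> //.
have : L * g t <= L * g t' by rewrite ler_wpM2l // g_mono // ltW.
rewrite /G; lra.
Qed.

(** * Weak stability of the fluid model *)

Theorem theorem5 (R : realType) (K : nat) (Lam : 'M[R]_K) (lam0 : 'cV[R]_K)
    (mu : 'rV[R]_K)
    (K_gt0 : (0 < K)%N)
    (Lam_ge0 : forall i j : 'I_K, 0 <= Lam i j)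
    (lam0_ge0 : forall j : 'I_K, 0 <= lam0 j 0)
    (mu_gt0 : forall i : 'I_K, 0 < mu 0 i)
    (M_ge0 : forall i j : 'I_K, 0 <= Mmx Lam mu i j)
    (M_irr : irreducible_mx (Mmx Lam mu)) :
  spectral_radius (Mmx Lam mu) <= 1 -> weakly_stable Lam lam0 mu.
Proof.
move=> rho1 Q T Y [T0 Tmono YE Ymono Q0 Qbal Qidle] Qinit t1 t1_ge0.
have [v vP] := perron_subinvariant K_gt0 M_ge0 M_irr rho1.
have v0 i : 0 < v i 0 by have [] := vP i.
set M := Mmx Lam mu in M_ge0 vP Qbal.
pose w t := (v^T *m Q t) 0 0.
pose c := (v^T *m lam0) 0 0.
have wE t : w t = \sum_i v i 0 * Q t i 0.
  by rewrite /w mxE; apply: eq_bigr => i _; rewrite mxE.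
have c0 : 0 <= c.
  by rewrite /c mxE sumr_ge0 // => i _; rewrite mxE mulr_ge0 // ltW.
have w_incr s t : 0 <= s -> s <= t -> w t - w s <= c * (Y t - Y s).
  move=> s0 st; have t0 := le_trans s0 st.
  pose D := Gmx mu *m (T t - T s).
  have D0 i : 0 <= D i 0.
    by rewrite /D /Gmx mul_diag_mx !mxE mulr_ge0 ?subr_ge0 ?Tmono // ltW.
  have QE : Q t - Q s = (M^T - 1%:M) *m D + (Y t - Y s) *: lam0.
    rewrite /D (Qbal t) // (Qbal s) // Qinit !add0r 2!mulmxBr scalerBl.
    by rewrite opprD addrACA.
  have -> : w t - w s = (v^T *m (Q t - Q s)) 0 0.
    by rewrite mulmxBr [RHS]mxE [X in _ = _ + X]mxE.
  have vE : v^T *m (M^T - 1%:M) = (M *m v - v)^T.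
    by rewrite mulmxBr mulmx1 -trmx_mul linearB.
  rewrite QE mulmxDr mulmxA vE -scalemxAr mxE [X in _ + X]mxE [X in _ + X]mulrC.
  rewrite gerDr mxE sumr_le0 // => i _; rewrite mulr_le0_ge0 // mxE mxE [X in _ + X]mxE subr_le0.
  by have [] := vP i.
have Ylip s t : 0 <= s -> s <= t -> Y t - Y s <= t - s.
  move=> s0 st; rewrite !YE ?(le_trans s0 st) //.
  have : \sum_i T s i 0 <= \sum_i T t i 0 by apply: ler_sum => i _; exact: Tmono.
  lra.
have w_lip s t : 0 <= s -> s <= t -> t <= t1 -> w t - w s <= c * (t - s).
  move=> s0 st _; apply: le_trans (w_incr _ _ s0 st) _.
  by rewrite ler_wpM2l // Ylip.
have w00 : w 0 <= 0 by rewrite /w Qinit mulmx0 mxE.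
have [a [a0 at1 wa wpos]] := last_sublevel_point t1_ge0 w00 w_lip.
(* [Y] is given by this formula only for [t >= 0]. [F] extends it to the whole line, so its
   derivative follows directly from those of the [T i]. *)
pose F t := t - \sum_i T t i 0.
have FY t : 0 <= t -> F t = Y t by move=> /YE.
have YF : F t1 <= F a.
  apply: (@ae_derive_le0_nonincreasing _ F a t1 1) => //.
    by move=> s t as_ st _; rewrite mul1r !FY ?Ylip // (le_trans _ as_, le_trans _ (le_trans as_ st)).
  move: Qidle; rewrite /prop_near1 /=; apply: negligibleS => t; apply: contra_not => idle at_ tt1.
  have t0 : 0 < t by exact: le_lt_trans at_.
  have Qn0 : Q t != 0.
    apply: contraTneq (wpos _ at_ (ltW tt1)) => Qt0.
    by rewrite /w Qt0 mulmx0 mxE ltxx.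
  have [dT sumT] := idle t0 Qn0.
  have FE : F = id - \sum_(i < K) (fun s => T s i 0).
    by apply/funext => s; rewrite /F fctE /= fct_sumE.
  have dF : is_derive t 1 F (1 - \sum_(i < K) 'D_1 (fun s => T s i 0) t).
    rewrite FE; apply: is_deriveB.
    by apply: is_derive_sum => i; apply: derivableP.
  split; first exact: ex_derive.
  by rewrite derive1E derive_val; under eq_bigr do rewrite -derive1E; rewrite sumT subrr.
have wt1 : w t1 <= 0.
  apply: le_trans wa; rewrite -subr_le0; apply: le_trans (w_incr _ _ a0 at1) _.
  by rewrite mulr_ge0_le0 // subr_le0 -!FY.
(* The nonnegative terms [v_i * Q_i] sum to zero, and strict positivity of [v] forces each [Q_i] to
   vanish. *)
apply/colP => i; rewrite mxE; apply/eqP.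
have : \sum_i v i 0 * Q t1 i 0 == 0.
  rewrite eq_le -wE wt1 wE sumr_ge0 // => k _.
  by rewrite mulr_ge0 ?Q0 // ltW.
rewrite psumr_eq0 => [/allP/(_ i)|k _]; last by rewrite mulr_ge0 ?Q0 // ltW.
by rewrite mem_index_enum mulf_eq0 gt_eqF // => /(_ isT).
Qed.
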